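(* There exists a universal constant $K$ with the following property. Let $(h_{ij})_{1\le i<j\le N}$ be an i.i.d. sequence of real random variables with $Eh_{ij}=Eh_{ij}^3=0$, $Eh_{ij}^2=1$, and assume that $E\exp(h_{ij})<2$ and $E\exp(-h_{ij})<2$. Let $0<\beta<1$ and $$Z_N=2^{-N}\sum_{(\epsilon_i)\in\{-1,1\}^N}\exp\Big(\frac{\beta}{\sqrt N}\sum_{1\le i<j\le N}h_{ij}\epsilon_i\epsilon_j\Big).$$ Then, for $0<t<N/K$, $$P\Big(\Big|\log Z_N-\frac{\beta^2N}{4}\Big|\ge K\Big(t+\sqrt{\log\frac{K}{1-\beta^2}}\Big)\sqrt N\Big)\le2e^{-t^2}.$$ In particular, $$-\frac{K}{\sqrt N}\sqrt{\log\frac{2}{1-\beta^2}}\le\frac1NE\log Z_N-\frac{\beta^2}{4}\le\frac KN .$$ *)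

(* Defs.v *)
From mathcomp Require Import all_boot all_order all_algebra.
From mathcomp Require Import all_classical all_reals all_analysis.
Import Order.TTheory GRing.Theory Num.Theory.
Import numFieldNormedType.Exports.

Set Implicit Arguments.
Unset Strict Implicit.
Unset Printing Implicit Defensive.

Local Open Scope classical_set_scope.
Local Open Scope ring_scope.

(* Only the members of the family with index in A are constrained. *)
Definition mutually_independent (d : measure_display) (T : measurableType d)
    (R : realType) (P : probability T R) (I : finType) (A : {set I})
    (X : I -> {RV P >-> R}) : Prop :=
  forall (J : {set I}) (B : I -> set R),
    J \subset A -> (forall i, measurable (B i)) ->
    P (\bigcap_(i in [set` J]) X i @^-1` B i) =
    (\prod_(i in J) P (X i @^-1` B i))%E.

(* The two laws are compared on Borel sets only: off the sigma-algebra the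
   values of the pushforward carry no meaning. *)
Definition identically_distributed (d : measure_display)
    (T : measurableType d) (R : realType) (P : probability T R)
    (I : finType) (A : {set I}) (X : I -> {RV P >-> R}) : Prop :=
  forall i j, i \in A -> j \in A ->
    forall B : set R, measurable B ->
      distribution P (X i) B = distribution P (X j) B.

Definition iid (d : measure_display) (T : measurableType d) (R : realType)
    (P : probability T R) (I : finType) (A : {set I})
    (X : I -> {RV P >-> R}) : Prop :=
  mutually_independent A X /\ identically_distributed A X.

Definition pairs_lt (N : nat) : {set 'I_N * 'I_N} :=
  [set p : 'I_N * 'I_N | (p.1 < p.2)%N]%SET.

(* {-1, 1}^N is indexed by Boolean functions through
   epsilon_i = (-1) ^+ s i. *)
Definition spin (R : realType) (N : nat) (s : {ffun 'I_N -> bool})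
    (i : 'I_N) : R := (-1) ^+ s i.

Definition Z (R : realType) (N : nat) (beta : R) (g : 'I_N * 'I_N -> R) : R :=
  2 ^- N * \sum_(s : {ffun 'I_N -> bool})
    expR (beta / Num.sqrt N%:R *
      \sum_(p in pairs_lt N) g p * spin R s p.1 * spin R s p.2).

(* Main.v *)
(* The free energy F = log Z is nonnegative (Jensen over the spins) and moves by
   at most a = beta / sqrt N times the change of any single h_ij. Integrating the
   coordinates one at a time, the exponential tails of h_ij give
   E exp(l (F - E F)) <= exp(16 l^2 N) for |l| a <= 1; Markov's inequality turns
   this into the deviation bound around E F. Since E h = E h^3 = 0 and E h^2 = 1,
   E exp(y h) = 1 + y^2/2 + O(y^4), so E Z = exp(beta^2 N/4 + O(1)), which bounds
   E F from above. A Gaussian-type bound for sums of signs gives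
   E Z^2 <= C (E Z)^2 / (1 - beta^2). From below,
   Z <= tau^(1-l) Z^l + Z^2/tau with tau of order E Z / (1 - beta^2) shows that
   E Z^l is large, while concentration gives E Z^l <= exp(l E F + 16 l^2 N);
   the choice l^2 ~ log(1/(1 - beta^2)) / N yields the lower bound on E F. *)

From HB Require Import structures.
Require Import Defs.
From mathcomp Require Import all_boot all_order all_algebra.
From mathcomp Require Import all_classical all_reals all_analysis.
From mathcomp Require Import measurable_realfun.
From mathcomp Require Import ring lra.
Import Order.TTheory GRing.Theory Num.Theory.
Import numFieldNormedType.Exports.

Local Open Scope classical_set_scope.
Local Open Scope ring_scope.

(** * Elementary inequalities for the exponential function *)

Section exponential.
Context {R : realType}.
Implicit Types a f h l q t u x y W : R.

(** For [k >= n] one has [|x| ^+ k <= |x| ^+ n], so the tail of the series at [x * h] is at most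
    [|x| ^+ n] times the tail of the series of [expR |h|]. Splitting the argument keeps the small
    factor [x] apart from the unbounded [h]. *)
Lemma expR_remainder n x h : `|x| <= 1 ->
  `|expR (x * h) - \sum_(0 <= k < n) (x * h) ^+ k / k`!%:R|
    <= `|x| ^+ n * expR `|h|.
Proof.
move=> x1.
set S := \sum_(0 <= k < n) _.
have cv : (fun M => series (exp_coeff (x * h)) M) @ \oo --> expR (x * h).
  exact: is_cvg_series_exp_coeff.
have cvn : (fun M => `|series (exp_coeff (x * h)) M - S|) @ \oo
    --> `|expR (x * h) - S|.
  by apply: cvg_norm; apply: cvgB => //; exact: cvg_cst.
rewrite -(cvg_lim _ cvn)//; apply: limr_le; first by apply/cvg_ex; eexists; exact: cvn.
near=> M.
have nM : (n <= M)%N by near: M; exact: nbhs_infty_ge.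
rewrite /series /= /exp_coeff (big_cat_nat (leq0n n) nM) /= -/S addrAC subrr add0r.
have term k : (n <= k)%N -> `|(x * h) ^+ k / k`!%:R| <=
    `|x| ^+ n * (`|h| ^+ k / k`!%:R).
  move=> nk; rewrite normrM normrX normrM exprMn normfV normr_nat mulrA.
  apply: ler_wpM2r; first by rewrite invr_ge0.
  apply: ler_wpM2r; first by rewrite exprn_ge0.
  by apply: ler_wiXn2l => //; rewrite normr_ge0.
apply: le_trans (ler_norm_sum _ _ _) _.
rewrite big_nat_cond.
apply: (@le_trans _ _ (\sum_(n <= k < M) `|x| ^+ n * (`|h| ^+ k / k`!%:R))).
  rewrite [leRHS]big_nat_cond; apply: ler_sum => k /andP[/andP[nk _] _].
  exact: term.
rewrite -mulr_sumr; apply: ler_wpM2l; first by rewrite exprn_ge0.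
have ndE : nondecreasing_seq (series (exp_coeff `|h|)).
  apply/nondecreasing_seqP => m; rewrite /series/= big_nat_recr//= lerDl.
  by apply: exp_coeff_ge0; rewrite normr_ge0.
have := nondecreasing_cvgn_le ndE (is_cvg_series_exp_coeff `|h|) M.
rewrite -/(expR `|h|); apply: le_trans.
rewrite /series /= /exp_coeff [leRHS](big_cat_nat (leq0n n) nM) /= lerDr.
by apply: sumr_ge0 => k _; rewrite divr_ge0// exprn_ge0.
Unshelve. all: by end_near.
Qed.

Lemma expR_taylor4 x h : `|x| <= 1 ->
  `|expR (x * h) - (1 + x * h + (x * h) ^+ 2 / 2 + (x * h) ^+ 3 / 6)|
    <= x ^+ 4 * expR `|h|.
Proof.
move=> x1; have := expR_remainder 4 x h x1.
rewrite !big_nat_recr//= big_nil !factS fact0 expr0 expr1 ?muln1 add0r.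
rewrite -normrX (ger0_norm (_ : 0 <= x ^+ 4)) ?exprn_even_ge0// !divr1.
by [].
Qed.

(** Second-order remainder for [u = t * (u / t)], where [|u / t| <= W]. *)
Lemma expR_quadratic_le t u W : 0 <= t <= 1 -> `|u| <= t * W ->
  expR u <= 1 + u + t ^+ 2 * expR W.
Proof.
move=> /andP[t0 t1] uW.
have [t_eq0|tn0] := eqVneq t 0.
  move: uW; rewrite t_eq0 mul0r normr_le0 => /eqP ->.
  by rewrite expR0 expr0n /= mul0r !addr0.
have tp : 0 < t by rewrite lt_def tn0 t0.
have := @expR_remainder 2 t (u / t).
rewrite ger0_norm// mulrC divfK// => /(_ t1).
rewrite !big_nat_recr//= big_nil !factS fact0 expr0 expr1 ?muln1 add0r !divr1.
move=> /(le_trans (ler_norm _)); rewrite lerBlDl => /le_trans; apply.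
rewrite lerD2l ler_wpM2l ?exprn_ge0// ler_expR normf_div (ger0_norm t0).
by rewrite ler_pdivrMr// mulrC.
Qed.

Lemma expR1_le4 : expR 1 <= 4 :> R.
Proof.
have h : expR (1 / 2) <= 2 :> R.
  rewrite -[leLHS]invrK -expRN -[leRHS]invrK lef_pV2 ?posrE ?expR_gt0 ?invr_gt0//.
  have := expR_ge1Dx (- (1 / 2) : R); lra.
have -> : (1 : R) = 1 / 2 + 1 / 2 by lra.
rewrite expRD; have := expR_ge0 (1 / 2 : R); nra.
Qed.

Lemma expR_le_inv1B u : u < 1 -> expR u <= (1 - u)^-1.
Proof.
move=> u1; rewrite -[expR u]invrK -expRN lef_pV2 ?posrE ?expR_gt0 ?subr_gt0//.
exact: expR_ge1Dx.
Qed.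

Lemma expR_taylor2_le u : 0 <= u <= 1 / 2 -> expR u <= 1 + u + 2 * u ^+ 2.
Proof.
move=> /andP[u0 u1]; apply: le_trans (expR_le_inv1B _ _) _; first lra.
rewrite -[leLHS]mul1r ler_pdivrMr; last lra.
nra.
Qed.

(** The odd Taylor terms at [u] and [- u] cancel; the quartic error is [u ^+ 4 * expR 1]. *)
Lemma cosh_small_le u : `|u| <= 1 ->
  (expR u + expR (- u)) / 2 <= expR (u ^+ 2 / 2 + 4 * u ^+ 4).
Proof.
move=> u1.
have hp : expR u <= 1 + u + u ^+ 2 / 2 + u ^+ 3 / 6 + 4 * u ^+ 4.
  have := @expR_taylor4 u 1 u1; rewrite mulr1 normr1 => /(le_trans (ler_norm _)).
  have := expR1_le4; have : 0 <= u ^+ 4 by rewrite exprn_even_ge0.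
  nra.
have hm : expR (- u) <= 1 - u + u ^+ 2 / 2 - u ^+ 3 / 6 + 4 * u ^+ 4.
  have := @expR_taylor4 (- u) 1; rewrite normrN mulr1 normr1 => /(_ u1).
  move=> /(le_trans (ler_norm _)).
  have -> : (- u) ^+ 2 = u ^+ 2 by ring.
  have -> : (- u) ^+ 3 = - u ^+ 3 by ring.
  have -> : (- u) ^+ 4 = u ^+ 4 by ring.
  have := expR1_le4; have : 0 <= u ^+ 4 by rewrite exprn_even_ge0.
  nra.
have := expR_ge1Dx (u ^+ 2 / 2 + 4 * u ^+ 4); lra.
Qed.

(* With [c] the hyperbolic cosine, [c (2 v) = 2 c v ^ 2 - 1], and
   [2 e - 1 <= e ^ 2], so bounds [c v <= exp (k v ^ 2)] survive doubling. *)
Lemma cosh_halving_le n u : `|u| <= 2 ^+ n ->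
  (expR u + expR (- u)) / 2 <= expR (u ^+ 2 / 2 + 4 * u ^+ 4 / 4 ^+ n).
Proof.
elim: n u => [|n IH] u.
  by rewrite !expr0 divr1; exact: cosh_small_le.
move=> un; have := IH (u / 2).
rewrite normrM normfV (ger0_norm (_ : 0 <= 2))// ler_pdivrMr// -exprSr => /(_ un).
set v := u / 2; set q := (_ ^+ 2 / 2 + _).
have uE : u = v + v by rewrite /v; lra.
(* Doubling the argument multiplies the quadratic term by 4 and the quartic one by 16, a factor 4 of
   which is absorbed by [4 ^+ n.+1]. *)
have -> : u ^+ 2 / 2 + 4 * u ^+ 4 / 4 ^+ n.+1 = (q + q) + (q + q).
  have : (4 : R) ^+ n != 0 by rewrite expf_neq0 ?pnatr_eq0.
  rewrite /q (exprS _ n) uE; move: (4 ^+ n) => c c0; clearbody v.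
  by field.
clearbody q; rewrite uE opprD !expRD.
have := expR_ge0 v; have := expR_ge0 (- v).
have : expR v * expR (- v) = 1 by rewrite -expRD subrr expR0.
have := expR_ge0 q.
move: (expR v) (expR (- v)) (expR q) => a b e e0 ab b0 a0 abe.
have : ((a + b) / 2) ^+ 2 <= e ^+ 2.
  by rewrite ler_pXn2r// nnegrE; lra.
rewrite !expr2 => h; have := sqr_ge0 (e * e - 1); rewrite expr2.
nra.
Qed.

(** Limit of [cosh_halving_le]: as [n] grows, the quartic error falls below any [e > 0]. *)
Lemma cosh_le u : (expR u + expR (- u)) / 2 <= expR (u ^+ 2 / 2).
Proof.
have cosh0 : 0 < (expR u + expR (- u)) / 2.
  by rewrite divr_gt0// addr_gt0// expR_gt0.
rewrite -[leLHS]lnK ?posrE// ler_expR.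
apply/ler_addgt0Pr => e e0.
have [m mu] : exists m : nat, `|u| <= 2 ^+ m /\ 4 * u ^+ 4 / 4 ^+ m <= e.
  pose y := Num.max `|u| (4 * u ^+ 4 / e).
  have y0 : 0 <= y by rewrite le_max normr_ge0.
  exists (Num.bound y).
  have yb : y < (Num.bound y)%:R.
    by exact: archi_boundP.
  have b2 : (Num.bound y)%:R <= 2 ^+ Num.bound y :> R.
    by rewrite -natrX ler_nat ltnW// ltn_expl.
  have b4 : (Num.bound y)%:R <= 4 ^+ Num.bound y :> R.
    by rewrite -natrX ler_nat ltnW// ltn_expl.
  split.
    apply: (le_trans _ b2); apply/ltW; apply: (le_lt_trans _ yb).
    by rewrite le_max lexx.
  rewrite ler_pdivrMr ?exprn_gt0// [leRHS]mulrC -ler_pdivrMr//.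
  apply: (le_trans _ b4); apply/ltW; apply: (le_lt_trans _ yb).
  by rewrite le_max lexx orbT.
have [um me] := mu.
have := cosh_halving_le _ _ um.
rewrite -{1}[X in X <= _]lnK ?posrE// ler_expR => /le_trans; apply.
by rewrite lerD2l.
Qed.

(* For an independent sign this is [E exp (a (y + eps)^2)], bounded by the same
   functional of a standard Gaussian with its prefactor squared. The bound
   reproduces itself when signs are summed one at a time. *)
Lemma expR_sqr_sign_le a y : 0 <= a -> 2 * a < 1 ->
  (expR (a * (y + 1) ^+ 2) + expR (a * (y - 1) ^+ 2)) / 2 <=
  (1 - 2 * a)^-1 * expR (a / (1 - 2 * a) * y ^+ 2).
Proof.
move=> a0 a1.
have -> : a * (y + 1) ^+ 2 = a * y ^+ 2 + a + 2 * a * y by ring.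
have -> : a * (y - 1) ^+ 2 = a * y ^+ 2 + a + - (2 * a * y) by ring.
rewrite expRD [X in _ + X]expRD -mulrDr -mulrA.
have := cosh_le (2 * a * y) => /(ler_wpM2l (expR_ge0 (a * y ^+ 2 + a))).
move=> /le_trans; apply.
rewrite -expRD.
have -> : a * y ^+ 2 + a + (2 * a * y) ^+ 2 / 2 = a + (a + 2 * a ^+ 2) * y ^+ 2.
  by field.
rewrite expRD; apply: ler_pM; rewrite ?expR_ge0//.
  apply: le_trans (expR_le_inv1B _ _) _; first lra.
  by rewrite lef_pV2 ?posrE; lra.
(* [(a + 2 a^2) (1 - 2 a) = a - 4 a^3 <= a]. *)
rewrite ler_expR ler_wpM2r ?sqr_ge0// ler_pdivlMr; last lra.
have : 0 <= a ^+ 3 by rewrite exprn_ge0.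
nra.
Qed.

(* Interpolates between the exponents [l], controlled by concentration, and [2],
   controlled by the second moment, with threshold [q]. *)
Lemma expR_interpolation f l q : 0 <= l <= 1 ->
  expR f <= expR ((1 - l) * q) * expR (l * f) + expR (- q) * expR f ^+ 2.
Proof.
move=> /andP[l0 l1]; rewrite -expRM_natl -!expRD.
(* Below [q] the first term suffices, as [f <= (1 - l) q + l f]; above [q] the second does, as
   [f <= 2 f - q]. *)
have [fq|qf] := lerP f q.
  apply: (@le_trans _ _ (expR ((1 - l) * q + l * f))); last by rewrite lerDl expR_ge0.
  rewrite ler_expR; nra.
apply: (@le_trans _ _ (expR (- q + 2%:R * f))); last by rewrite lerDr expR_ge0.
rewrite ler_expR; lra.
Qed.

End exponential.

(** * Decoupling of independent coordinates *)

Section resampling.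
Context {d : measure_display} {T : measurableType d} {R : realType}.
Context {P : probability T R} {I : finType}.
Implicit Types (A J : {set I}) (v : I -> R) (p : I).

Definition update v p (x : R) : I -> R := fun i => if i == p then x else v i.

Variable h : I -> {RV P >-> R}.

(** Coordinates in [J] are random and the others frozen at [v], so that an induction on [J]
    integrates one coordinate at a time. *)
Definition resample J v (w : T) : I -> R :=
  fun i => if i \in J then h i w else v i.

Lemma resample0 v w : resample finset.set0 v w = v.
Proof. by apply/funext => i; rewrite /resample finset.inE. Qed.

Lemma resampleU1 J p v w : p \notin J ->
  resample (p |: J)%SET v w = resample J (update v p (h p w)) w.
Proof.
move=> pJ; apply/funext => i; rewrite /resample /update !finset.inE.
by case: eqVneq => [->|//]; rewrite (negbTE pJ).
Qed.

Lemma resample_update J p v w x : p \notin J ->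
  resample J (update v p x) w = update (resample J v w) p x.
Proof.
move=> pJ; apply/funext => i; rewrite /resample /update.
by case: eqVneq => [->|//]; rewrite (negbTE pJ).
Qed.

(* Giving [T] the sigma-algebra generated by these sets makes [(h i)_(i in J)] a
   single variable, the identity, independent of any further [h p]. *)
Definition cylinders J : set (set T) :=
  [set \bigcap_(i in [set` J]) h i @^-1` B i | B in
    [set B : I -> set R | forall i, measurable (B i)]].

Lemma measurable_cylinders J : cylinders J `<=` measurable.
Proof.
move=> _ [B mB <-]; apply: fin_bigcap_measurable => [|i _].
  exact: finite_finset.
exact: measurable_funPTI.
Qed.

Lemma setI_closed_cylinders J : setI_closed (cylinders J).
Proof.
move=> _ _ [B mB <-] [C mC <-]; exists (fun i => B i `&` C i).
  by move=> i; exact: measurableI.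
by rewrite -bigcapI; apply: eq_bigcapr => i _; rewrite preimage_setI.
Qed.

Lemma cylindersT J : cylinders J setT.
Proof.
by exists (fun=> setT) => //; apply/seteqP; split.
Qed.

Local Notation TJ J := (g_sigma_algebraType (cylinders J)).

Lemma measurable_forget J : measurable_fun setT (id : T -> TJ J).
Proof.
move=> _ B mB; rewrite setTI preimage_id.
exact: (smallest_sub (@sigma_algebra_measurable _ T) (@measurable_cylinders J)).
Qed.

Lemma measurable_coordinate J i : i \in J ->
  measurable_fun setT (h i : TJ J -> R).
Proof.
move=> iJ _ B mB; rewrite setTI; apply: sub_sigma_algebra.
exists (fun j => if j == i then B else setT).
  by move=> j; case: ifP.
apply/seteqP; split => w /=.
  by move=> /(_ i iJ); rewrite eqxx.
by move=> hB j _; case: eqP => // ->.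
Qed.


(** Both sides are finite measures in [C] that agree on the cylinders, a pi-system generating the
    sigma-algebra. *)
Lemma indep_coordinate_cylinders A J p (D C : set _) :
  mutually_independent A h -> p \in A -> J \subset A -> p \notin J ->
  measurable D -> <<s cylinders J >> C ->
  P (h p @^-1` D `&` C) = (P (h p @^-1` D) * P C)%E.
Proof.
move=> ind pA JA pJ mD; rewrite setIC.
have mhD : measurable (h p @^-1` D) by exact: measurable_funPTI.
have PD0 : 0 <= fine (P (h p @^-1` D)) by exact: fine_ge0.
have PDE : P (h p @^-1` D) = (fine (P (h p @^-1` D)))%:E.
  by rewrite fineK// fin_num_measure.
pose m1 : {measure set T -> \bar R} := mrestr P mhD.
pose m2 : {measure set T -> \bar R} := mscale (NngNum PD0) P.
have m1E X : m1 X = P (X `&` h p @^-1` D) by [].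
have m2E X : m2 X = (P (h p @^-1` D) * P X)%E by rewrite [in RHS]PDE.
move=> sC; rewrite -m1E -m2E.
move: C sC; apply: (g_sigma_algebra_measure_unique (cylinders J) _ (fun=> setT)).
- exact: measurable_cylinders.
- by move=> _; exact: cylindersT.
- by apply/seteqP; split => // w _; exists 0%N.
- exact: setI_closed_cylinders.
- move=> _ [B mB <-]; rewrite m1E m2E.
  have pJA : (p |: J)%SET \subset A by rewrite finset.subUset finset.sub1set pA.
  (* Placing [D] at coordinate [p] makes the intersection a cylinder over [p |: J], to which
     independence applies. *)
  have mB' i : measurable ((if i == p then D else B i)) by case: ifP.
  have := ind _ _ pJA mB'; rewrite big_setU1//= eqxx.
  rewrite (ind _ _ JA mB).
  rewrite [in X in _ -> _ = X](eq_bigr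
    (fun i => P (h i @^-1` (if i == p then D else B i)))); last first.
    by move=> i iJ; case: eqVneq => // ip; rewrite -ip iJ in pJ.
  move=> <-; congr (P _); apply/seteqP; split => w /=.
    move=> [hB hD] i; rewrite /= finset.in_setU1; case: eqVneq => [-> _//|_ /=].
    exact: hB.
  move=> hB; split.
    move=> i /= iJ; have := hB i; rewrite /= finset.in_setU1 iJ orbT => /(_ isT).
    by case: eqVneq => // ip; rewrite -ip iJ in pJ.
  by have := hB p; rewrite /= finset.in_setU1 eqxx => /(_ isT).
- by move=> _; rewrite m1E ltey_eq fin_num_measure//; exact: measurableI.
Qed.

(** The joint law of [h p] and the identity into [TJ J] is a product measure by
    [indep_coordinate_cylinders]; Tonelli then gives the iterated integral. *)
Lemma ge0_integral_decouple A J p (f : R * TJ J -> \bar R) :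
  mutually_independent A h -> p \in A -> J \subset A -> p \notin J ->
  measurable_fun setT f -> (forall z, 0 <= f z)%E ->
  (\int[P]_w f (h p w, w) = \int[P]_w \int[P]_w' f (h p w, w'))%E.
Proof.
move=> ind pA JA pJ mf f0.
pose idJ : {mfun T >-> TJ J} :=
  HB.pack (id : T -> TJ J) (isMeasurableFun.Build _ _ _ _ _ (measurable_forget J)).
have mpair : measurable_fun setT (fun w => (h p w, idJ w)).
  by apply/measurable_fun_pairP; split.
pose pr : {mfun T >-> (R * TJ J)%type} :=
  HB.pack (fun w => (h p w, idJ w)) (isMeasurableFun.Build _ _ _ _ _ mpair).
transitivity (\int[distribution P pr]_z f z)%E.
  by rewrite ge0_integral_distribution.
rewrite (eq_measure_integral (distribution P (h p) \x distribution P idJ)%E).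
  rewrite fubini_tonelli1//= ge0_integral_distribution//=; last 2 first.
  - exact: measurable_fun_fubini_tonelli_F.
  - by move=> x; apply: integral_ge0 => y _.
  apply: eq_integral => w _; rewrite /= /fubini_F ge0_integral_distribution//.
  exact: measurableT_comp.
move=> X mX _; apply/esym/product_measure_unique => // B C mB mC.
rewrite /distribution /pushforward.
rewrite -(indep_coordinate_cylinders A J p _ _ ind pA JA pJ mB mC).
by congr (P _); apply/seteqP; split.
Qed.

End resampling.
Arguments resample {d T R P I} h J v w.
Arguments cylinders {d T R P I} h J.

(** * Finite real means and Markov's inequality *)

Section mean.
Context {d : measure_display} {T : measurableType d} {R : realType}.
Variable P : probability T R.
Implicit Types (f g : T -> R) (c m : R).

(** A relation: integrability travels with a real value, so that bounds on means are handled by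
    arithmetic in [R]. *)
Definition mean f m :=
  P.-integrable setT (EFin \o f) /\ (\int[P]_w (f w)%:E = m%:E)%E.

Lemma mean_measurable f m : mean f m -> measurable_fun setT f.
Proof. by move=> [/integrableP[/measurable_EFinP]]. Qed.

Lemma eq_mean f g m : f =1 g -> mean f m -> mean g m.
Proof. by move=> /funext <-. Qed.

Lemma mean_cst c : mean (fun=> c) c.
Proof.
split; last by rewrite integral_cst//= probability_setT mule1.
exact: finite_measure_integrable_cst.
Qed.

Lemma meanD f g m n : mean f m -> mean g n -> mean (fun w => f w + g w) (m + n).
Proof.
move=> [fi fm] [gi gn]; split.
  by apply: eq_integrable (integrableD _ fi gi).
by rewrite (integralD_EFin _ fi gi)// fm gn.
Qed.

Lemma meanZ c f m : mean f m -> mean (fun w => c * f w) (c * m).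
Proof.
move=> [fi fm]; split.
  by apply: eq_integrable (integrableZl _ c fi).
under eq_integral do rewrite EFinM.
by rewrite integralZl// fm.
Qed.

Lemma mean_le f g m n : mean f m -> mean g n -> (forall w, f w <= g w) -> m <= n.
Proof.
move=> [fi fm] [gi gn] fg; rewrite -lee_fin -fm -gn.
by apply: le_integral => // w _; rewrite lee_fin.
Qed.

Lemma mean_dominated f g n : measurable_fun setT f -> mean g n ->
  (forall w, `|f w| <= g w) -> exists m, mean f m.
Proof.
move=> mf [gi gn] fg; have fi : P.-integrable setT (EFin \o f).
  apply: (le_integrable _ _ _ gi) => //; first exact/measurable_EFinP.
  by move=> w _ /=; rewrite lee_fin (le_trans (fg w))// ler_norm.
exists (fine (\int[P]_w (f w)%:E)%E); split => //.
by rewrite fineK// integrable_fin_num.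
Qed.

Lemma mean_ge0 f M : measurable_fun setT f -> (forall w, 0 <= f w) ->
  (\int[P]_w (f w)%:E <= M%:E)%E -> exists m, mean f m /\ m <= M.
Proof.
move=> mf f0 fM.
have i0 : (0 <= \int[P]_w (f w)%:E)%E.
  by apply: integral_ge0 => w _; rewrite lee_fin.
have ifin : (\int[P]_w (f w)%:E)%E \is a fin_num.
  by rewrite ge0_fin_numE// (le_lt_trans fM) ?ltry.
exists (fine (\int[P]_w (f w)%:E)%E); split.
  split; last by rewrite fineK.
  apply/integrableP; split; first exact/measurable_EFinP.
  under eq_integral do rewrite /= ger0_norm//.
  by rewrite (le_lt_trans fM) ?ltry.
by rewrite -lee_fin fineK.
Qed.

End mean.
Arguments mean {d T R} P f m.

Lemma mean_markov {d : measure_display} {T : measurableType d} {R : realType}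
    (P : probability T R) (E : set T) (g : T -> R) (m : R) :
  measurable E -> mean P g m -> (forall w, 0 <= g w) ->
  (forall w, E w -> 1 <= g w) -> (P E <= m%:E)%E.
Proof.
move=> mE hg g0 g1; have mg := mean_measurable P _ _ hg.
rewrite -(proj2 hg) -(setIT E) -integral_indic//.
apply: ge0_le_integral => //.
- by apply/measurable_EFinP; exact: measurable_indic.
- exact/measurable_EFinP.
move=> w _; rewrite lee_fin indicE.
by case: (boolP (w \in E)) => //; rewrite inE => /g1.
Qed.

Lemma finset_induction {I : finType} (Q : {set I} -> Prop) :
  Q finset.set0 -> (forall p (J : {set I}), p \notin J -> Q J -> Q (p |: J)%SET) ->
  forall J, Q J.
Proof.
move=> Q0 QU J; have [n] := ubnP #|J|; elim: n J => // n IH J.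
rewrite ltnS => Jn; have [->//|[p pJ]] := finset.set_0Vmem J.
rewrite -(finset.setD1K pJ); apply: QU; first by rewrite finset.setD11.
by apply: IH; move: Jn; rewrite (finset.cardsD1 p J) pJ.
Qed.

Lemma measurable_prod_finset {d : measure_display} {S : measurableType d}
    {R : realType} {I : finType} (J : {set I}) (f : I -> S -> R) :
  (forall i, i \in J -> measurable_fun setT (f i)) ->
  measurable_fun setT (fun s => \prod_(i in J) f i s).
Proof.
move=> mf; under eq_fun do rewrite -big_enum.
by apply: measurable_prod => i; rewrite mem_enum; exact: mf.
Qed.

(* The function type [I -> R] carries no sigma-algebra here: measurability of
   [F] is expressed on all measurable families of coordinates. *)
Definition coordwise_measurable {I : Type} {R : realType}
    (F : (I -> R) -> R) : Prop :=
  forall (d : measure_display) (S : measurableType d) (u : I -> S -> R),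
    (forall i, measurable_fun setT (u i)) ->
    measurable_fun setT (fun s => F (u ^~ s)).

(** * Integration of independent coordinates *)

Section independence.
Context {d : measure_display} {T : measurableType d} {R : realType}.
Context {P : probability T R} {I : finType}.
Variable h : I -> {RV P >-> R}.
Variable A : {set I}.
Hypothesis ind : mutually_independent A h.
Implicit Types (J : {set I}) (v : I -> R) (p : I).

(** Coordinates are peeled off one at a time by [ge0_integral_decouple]; integrability follows from
    nonnegativity and the finite value of the integral. *)
Lemma mean_prod J (f : I -> R -> R) (m : I -> R) : J \subset A ->
  (forall i, measurable_fun setT (f i)) -> (forall i x, 0 <= f i x) ->
  (forall i, i \in J -> mean P (f i \o h i) (m i)) ->
  mean P (fun w => \prod_(i in J) f i (h i w)) (\prod_(i in J) m i).
Proof.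
move=> + mf f0; elim/(@finset_induction I): J => [|p J pJ IH] JA fm.
  rewrite big_set0; apply: eq_mean (mean_cst _ _) => w.
  by rewrite big_set0.
move: JA; rewrite finset.subUset finset.sub1set => /andP[pA JA].
have {}IH := IH JA (fun i iJ => fm i (finset.setU1r p iJ)).
have fp := fm p (finset.setU11 p J).
rewrite big_setU1//=.
suff E : (\int[P]_w (\prod_(i in (p |: J)%SET) f i (h i w))%:E =
    (m p * \prod_(i in J) m i)%:E)%E.
  have [|||n [nm _]] := @mean_ge0 _ _ _ P
      (fun w => \prod_(i in (p |: J)%SET) f i (h i w)) (m p * \prod_(i in J) m i).
  - by apply: measurable_prod_finset => i _; exact: measurableT_comp.
  - by move=> w; apply: prodr_ge0.
  - by rewrite E.
  - by case: (nm) => _; rewrite E => -[->].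
under eq_integral do rewrite big_setU1//=.
pose Phi (z : R * g_sigma_algebraType (cylinders h J)) : \bar R :=
  (f p z.1 * \prod_(i in J) f i (h i z.2))%:E.
rewrite (ge0_integral_decouple h A J p Phi)//; last 2 first.
- apply/measurable_EFinP; apply: measurable_funM.
    exact: measurableT_comp.
  apply: measurable_prod_finset => i iJ; apply: measurableT_comp => //.
  apply: measurableT_comp; first exact: measurable_coordinate.
  exact: measurable_snd.
- by move=> z; rewrite lee_fin mulr_ge0// prodr_ge0.
rewrite /Phi /=.
under eq_integral.
  move=> w _; rewrite (proj2 (meanZ P (f p (h p w)) _ _ IH)).
  rewrite mulrC.
  over.
by rewrite (proj2 (meanZ P _ _ _ fp)) mulrC.
Qed.

(** Tower property: [g x] is the conditional mean given that coordinate [p] equals [x], and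
    averaging [g] over [h p] releases that coordinate. Measurability of [g] is part of Tonelli's
    theorem. *)
Lemma mean_resampleU1 J p v (F : (I -> R) -> R) (g : R -> R) :
  coordwise_measurable F -> (forall u, 0 <= F u) ->
  p \in A -> J \subset A -> p \notin J ->
  (forall x, mean P (fun w => F (resample h J (update v p x) w)) (g x)) ->
  measurable_fun setT g /\
  forall m, mean P (g \o h p) m ->
    mean P (fun w => F (resample h (p |: J)%SET v w)) m.
Proof.
move=> mF F0 pA JA pJ Fg.
have mupd d' (S : measurableType d') (x : S -> R) (y : S -> T) :
    measurable_fun setT x ->
    (forall i, i \in J -> measurable_fun setT (h i \o y)) ->
    measurable_fun setT (fun s => F (resample h J (update v p (x s)) (y s))).
  move=> mx my; apply: mF => i; rewrite /resample /update.
  by case: (boolP (i \in J)) => iJ; [exact: my|case: (i == p)].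
split.
  apply/measurable_EFinP.
  pose f (z : R * T) : \bar R := (F (resample h J (update v p z.1) z.2))%:E.
  have -> : EFin \o g = fubini_F P f.
    by apply/funext => x; rewrite /fubini_F /f /= (proj2 (Fg x)).
  apply: measurable_fun_fubini_tonelli_F.
    apply/measurable_EFinP; apply: mupd => [|i _]; first exact: measurable_fst.
    by apply: measurableT_comp => //; exact: measurable_snd.
  by move=> z; rewrite lee_fin.
move=> m gm.
have E : (\int[P]_w (F (resample h (p |: J)%SET v w))%:E = m%:E)%E.
  under eq_integral do rewrite resampleU1//.
  pose Phi (z : R * g_sigma_algebraType (cylinders h J)) : \bar R :=
    (F (resample h J (update v p z.1) z.2))%:E.
  rewrite (ge0_integral_decouple h A J p Phi)//; last 2 first.
  - apply/measurable_EFinP; apply: mupd => [|i iJ]; first exact: measurable_fst.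
    exact: (measurableT_comp (measurable_coordinate h J i iJ) measurable_snd).
  - by move=> z; rewrite lee_fin.
  rewrite /Phi /=.
  under eq_integral do rewrite (proj2 (Fg _)).
  exact: (proj2 gm).
have [|||n [nm _]] := @mean_ge0 _ _ _ P
    (fun w => F (resample h (p |: J)%SET v w)) m.
- by apply: mF => i; rewrite /resample; case: (i \in _).
- by [].
- by rewrite E.
- by case: (nm) => _; rewrite E => -[->].
Qed.

End independence.

(** * Concentration *)

Section concentration.
Context {d : measure_display} {T : measurableType d} {R : realType}.
Context {P : probability T R}.

(** Averaging the Lipschitz bound gives [|g X - m| <= a (|X| + 1)]. In [expR_quadratic_le] with
    [t = |l| a] and [u = l (g X - m)], the linear term has mean zero and only the term in [t ^+ 2]
    remains. *)
Lemma mean_expR_lipschitz (X : {RV P >-> R}) (g : R -> R) (a mu m4 : R) :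
  0 <= a -> measurable_fun setT g ->
  (forall x y, g x <= g y + a * `|x - y|) ->
  mean P (fun w => `|X w|) mu -> mu <= 1 ->
  mean P (fun w => expR `|X w|) m4 -> m4 <= 4 ->
  exists m, mean P (g \o X) m /\
    forall l, `|l| * a <= 1 ->
      exists2 e, mean P (fun w => expR (l * g (X w))) e &
        e <= expR (l * m + 16 * (l * a) ^+ 2).
Proof.
move=> a0 mg gL Xmu mu1 X4 m44.
have mgX : measurable_fun setT (g \o X) by exact: measurableT_comp.
have [m gm] : exists m, mean P (g \o X) m.
  apply: (@mean_dominated _ _ _ P _ _ _ mgX
    (meanD P _ _ _ _ (mean_cst P `|g 0|) (meanZ P a _ _ Xmu))) => w /=.
  have := gL (X w) 0; have := gL 0 (X w); rewrite sub0r normrN subr0.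
  rewrite ler_norml; have := ler_norm (g 0); have := ler_norm (- g 0).
  rewrite normrN => ? ? ? ?.
  by apply/andP; split; lra.
exists m; split => // l la.
have upper x : g x <= m + (a * `|x| + a * mu).
  have := mean_le P _ _ _ _ (mean_cst P (g x))
    (meanD P _ _ _ _ gm (meanD P _ _ _ _ (mean_cst P (a * `|x|)) (meanZ P a _ _ Xmu))).
  apply=> w /=; apply: le_trans (gL x (X w)) _; rewrite lerD2l -mulrDr.
  by apply: ler_wpM2l => //; rewrite (le_trans (ler_normB _ _)).
have lower x : m <= g x + (a * `|x| + a * mu).
  have := mean_le P _ _ _ _ gm
    (meanD P _ _ _ _ (mean_cst P (g x))
      (meanD P _ _ _ _ (mean_cst P (a * `|x|)) (meanZ P a _ _ Xmu))).
  apply=> w /=; apply: le_trans (gL (X w) x) _; rewrite lerD2l -mulrDr.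
  by apply: ler_wpM2l => //; rewrite distrC (le_trans (ler_normB _ _)).
set t := `|l| * a.
have t01 : 0 <= t <= 1 by rewrite la mulr_ge0.
have bound w : expR (l * g (X w)) <=
    expR (l * m) * (1 + (l * (g (X w)) + - (l * m) + t ^+ 2 * expR 1 * expR `|X w|)).
  have -> : l * g (X w) = l * m + l * (g (X w) - m) by ring.
  rewrite expRD ler_wpM2l ?expR_ge0// -mulrA -expRD addrA.
  have -> : 1 + (l * m + l * (g (X w) - m) + - (l * m)) = 1 + l * (g (X w) - m).
    by ring.
  apply: expR_quadratic_le => //.
  rewrite normrM /t -mulrA ler_wpM2l// ler_norml.
  have := upper (X w); have := lower (X w).
  have : a * mu <= a by rewrite ler_piMr.
  by rewrite mulrDr mulr1 => ? ? ?; apply/andP; split; lra.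
have bm := meanZ P (expR (l * m)) _ _ (meanD P _ _ _ _ (mean_cst P 1)
  (meanD P _ _ _ _ (meanD P _ _ _ _ (meanZ P l _ _ gm) (mean_cst P (- (l * m))))
  (meanZ P (t ^+ 2 * expR 1) _ _ X4))).
have [||e em] := @mean_dominated _ _ _ P (fun w => expR (l * g (X w))) _ _ _ bm.
- by apply: measurableT_comp => //; exact: measurable_funM.
- by move=> w; rewrite ger0_norm ?expR_ge0//; exact: bound.
exists e => //; apply: le_trans (mean_le P _ _ _ _ em bm bound) _.
rewrite subrr add0r expRD ler_wpM2l ?expR_ge0//.
apply: le_trans (expR_ge1Dx _); rewrite lerD2l.
have -> : (l * a) ^+ 2 = t ^+ 2 by rewrite /t !exprMn real_normK ?num_real.
have := sqr_ge0 t; move: (t ^+ 2) => s s0.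
have := @expR1_le4 R; have := expR_ge0 (1 : R); move: (expR 1) => E E0 E4.
have m40 : 0 <= m4.
  by apply: (mean_le P _ _ _ _ (mean_cst P 0) X4) => w; exact: expR_ge0.
(* The constant 16 is the product of the bounds 4 on [expR 1] and on [m4]. *)
rewrite -mulrA mulrC ler_wpM2r// -[16]/(4 * 4)%:R natrM.
exact: ler_pM.
Qed.

Context {I : finType}.
Variables (h : I -> {RV P >-> R}) (A : {set I}) (a : R).
Variable F : (I -> R) -> R.
Hypothesis ind : mutually_independent A h.
Hypothesis a0 : 0 <= a.
Hypothesis mF : coordwise_measurable F.
Hypothesis F0 : forall v, 0 <= F v.
Hypothesis FL : forall p v x, p \in A -> F (update v p x) <= F v + a * `|x - v p|.
Hypothesis h1 : forall p, p \in A ->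
  exists2 mu, mean P (fun w => `|h p w|) mu & mu <= 1.
Hypothesis h4 : forall p, p \in A ->
  exists2 m4, mean P (fun w => expR `|h p w|) m4 & m4 <= 4.

(** Conditionally on coordinate [p], the induction hypothesis bounds the exponential moment by that
    of the conditional mean [g]. As [g] inherits the Lipschitz constant [a] of [F], averaging over
    [h p] costs one more [16 (l a)^2]. *)
Lemma mean_expR_resample (J : {set I}) : J \subset A -> forall v,
  exists m, mean P (fun w => F (resample h J v w)) m /\
    forall l, `|l| * a <= 1 ->
      exists2 e, mean P (fun w => expR (l * F (resample h J v w))) e &
        e <= expR (l * m + 16 * (l * a) ^+ 2 * #|J|%:R).
Proof.
elim/(@finset_induction I): J => [|p J pJ IH] JA v.
  exists (F v); split.
    by apply: eq_mean (mean_cst P _) => w; rewrite resample0.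
  move=> l _; exists (expR (l * F v)).
    by apply: eq_mean (mean_cst P _) => w; rewrite resample0.
  by rewrite finset.cards0 mulr0 addr0.
move: JA; rewrite finset.subUset finset.sub1set => /andP[pA JA].
have {}IH := IH JA.
pose g x := projT1 (cid (IH (update v p x))).
have gP x := projT2 (cid (IH (update v p x))).
rewrite -/(g _) in gP.
have gm x : mean P (fun w => F (resample h J (update v p x) w)) (g x).
  by have [] := gP x.
have [mg gstep] := mean_resampleU1 h A ind J p v F g mF F0 pA JA pJ gm.
have upd2 u x y : update (update u p y) p x = update u p x.
  by apply/funext => i; rewrite /update; case: eqP.
have gL x y : g x <= g y + a * `|x - y|.
  apply: (mean_le P _ _ _ _ (gm x) (meanD P _ _ _ _ (gm y) (mean_cst P _))) => w.
  rewrite !resample_update//; set u := resample h J v w.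
  by have := FL p (update u p y) x pA; rewrite upd2 /update eqxx.
have [mu hmu mu1] := h1 p pA; have [m4 hm4 m44] := h4 p pA.
have [m [hm mgf]] :=
  mean_expR_lipschitz (h p) g a mu m4 a0 mg gL hmu mu1 hm4 m44.
exists m; split; first exact: gstep.
move=> l la.
have [e0 he0 e0le] := mgf l la.
(* Conditional exponential moment given that coordinate [p] equals [x]. *)
pose G x := s2val (cid2 ((gP x).2 l la)).
have Gm x : mean P (fun w => expR (l * F (resample h J (update v p x) w))) (G x).
  exact: (s2valP (cid2 ((gP x).2 l la))).
have Gle x : G x <= expR (l * g x + 16 * (l * a) ^+ 2 * #|J|%:R).
  exact: (s2valP' (cid2 ((gP x).2 l la))).
have mexpF : coordwise_measurable (fun u => expR (l * F u)).
  move=> d' S u mu'; apply: measurableT_comp => //.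
  by apply: measurable_funM => //; exact: mF.
have [mG Gstep] := mean_resampleU1 h A ind J p v (fun u => expR (l * F u)) G mexpF
  (fun u => expR_ge0 _) pA JA pJ Gm.
have G0 x : 0 <= G x.
  by apply: (mean_le P _ _ _ _ (mean_cst P 0) (Gm x)) => w; exact: expR_ge0.
have bm := meanZ P (expR (16 * (l * a) ^+ 2 * #|J|%:R)) _ _ he0.
have Gb w : G (h p w) <= expR (16 * (l * a) ^+ 2 * #|J|%:R) * expR (l * g (h p w)).
  by rewrite -expRD addrC; exact: Gle.
have [||e he] := @mean_dominated _ _ _ P (G \o h p) _ _ _ bm.
- exact: measurableT_comp.
- by move=> w /=; rewrite ger0_norm.
exists e; first exact: Gstep.
apply: le_trans (mean_le P _ _ _ _ he bm Gb) _.
apply: le_trans (ler_wpM2l (expR_ge0 _) e0le) _.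
rewrite -expRD ler_expR finset.cardsU1 pJ natrD mulrDr mulr1; lra.
Qed.

End concentration.

(** * Moments of a single coupling *)

Section moments.
Context {d : measure_display} {T : measurableType d} {R : realType}.
Context {P : probability T R}.

Lemma mean_expectation (f : T -> R) (m n : R) :
  mean P f m -> ('E_P[f] = n%:E)%E -> m = n.
Proof. by rewrite unlock => -[_ ->] -[]. Qed.

Lemma mean_sum_bounds (S : finType) (f : S -> T -> R) (L U : S -> R) :
  (forall s, exists2 e, mean P (f s) e & L s <= e <= U s) ->
  exists2 e, mean P (fun w => \sum_s f s w) e & \sum_s L s <= e <= \sum_s U s.
Proof.
move=> H; elim: (index_enum S) => [|s r [e he /andP[le eu]]].
  exists 0; last by rewrite !big_nil lexx.
  by apply: eq_mean (mean_cst P 0) => w; rewrite big_nil.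
have [e' he' /andP[le' eu']] := H s.
exists (e' + e); last by rewrite !big_cons !lerD.
by apply: eq_mean (meanD P _ _ _ _ he' he) => w; rewrite big_cons.
Qed.

Variable X : {RV P >-> R}.
Hypothesis X1 : ('E_P[X] = 0)%E.
Hypothesis X3 : ('E_P[(fun w => X w ^+ 3)%R] = 0)%E.
Hypothesis X2 : ('E_P[(fun w => X w ^+ 2)%R] = 1)%E.
Hypothesis Xp : ('E_P[(fun w => expR (X w))%R] < 2%:E)%E.
Hypothesis Xm : ('E_P[(fun w => expR (- X w))%R] < 2%:E)%E.

Lemma mean_expR_norm : exists2 m4, mean P (fun w => expR `|X w|) m4 & m4 <= 4.
Proof.
have [||| e1 [he1 e12]] := @mean_ge0 _ _ _ P (fun w => expR (X w)) 2.
- exact: measurableT_comp.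
- by move=> w; exact: expR_ge0.
- by apply: ltW; move: Xp; rewrite unlock.
have [||| e2 [he2 e22]] := @mean_ge0 _ _ _ P (fun w => expR (- X w)) 2.
- by apply: measurableT_comp => //; exact: measurable_funN.
- by move=> w; exact: expR_ge0.
- by apply: ltW; move: Xm; rewrite unlock.
have le w : expR `|X w| <= expR (X w) + expR (- X w).
  by case: (ger0P (X w)) => _; rewrite ?lerDl ?lerDr expR_ge0.
have [||m hm] := @mean_dominated _ _ _ P (fun w => expR `|X w|) _ _ _
    (meanD P _ _ _ _ he1 he2).
- by do 2 apply: measurableT_comp => //.
- by move=> w; rewrite ger0_norm ?expR_ge0.
exists m => //; have := mean_le P _ _ _ _ hm (meanD P _ _ _ _ he1 he2) le; lra.
Qed.

(** Powers are dominated through [|x| ^+ k <= k! * expR |x|]. *)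
Lemma mean_pow k : exists m, mean P (fun w => X w ^+ k) m.
Proof.
have [m4 h4 _] := mean_expR_norm.
apply: (@mean_dominated _ _ _ P _ _ _ _ (meanZ P (k`!%:R) _ _ h4)).
  exact: measurable_funX.
move=> w; rewrite normrX; case: k => [|k].
  by rewrite expr0 fact0 mul1r; have := expR_ge1Dx `|X w|; have := normr_ge0 (X w); lra.
have := @expR_ge1Dxn R _ k (normr_ge0 (X w)) => h.
rewrite mulrC -ler_pdivrMr ?ltr0n ?fact_gt0//; lra.
Qed.

Lemma mean_X1 : mean P X 0.
Proof.
have [m hm] := mean_pow 1.
have {}hm : mean P X m by apply: eq_mean hm => w; rewrite expr1.
by rewrite -(mean_expectation _ _ _ hm X1).
Qed.

Lemma mean_X2 : mean P (fun w => X w ^+ 2) 1.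
Proof. by have [m hm] := mean_pow 2; rewrite -(mean_expectation _ _ _ hm X2). Qed.

Lemma mean_X3 : mean P (fun w => X w ^+ 3) 0.
Proof. by have [m hm] := mean_pow 3; rewrite -(mean_expectation _ _ _ hm X3). Qed.

Lemma mean_norm : exists2 mu, mean P (fun w => `|X w|) mu & mu <= 1.
Proof.
have b := meanZ P (2^-1) _ _ (meanD P _ _ _ _ (mean_cst P 1) mean_X2).
have le w : `|X w| <= 2^-1 * (1 + X w ^+ 2).
  rewrite -[X w ^+ 2]real_normK ?num_real//.
  have := sqr_ge0 (`|X w| - 1); nra.
have [||m hm] := @mean_dominated _ _ _ P (fun w => `|X w|) _ _ _ b.
- exact: measurableT_comp.
- by move=> w; rewrite normr_id.
by exists m => //; have := mean_le P _ _ _ _ hm b le; lra.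
Qed.

(** The first and third moments vanish, so the error is of order [y ^+ 4]. Summed over about
    [N^2 / 2] pairs with [y ^+ 2] of order [1 / N], such errors stay bounded. *)
Lemma mean_expRM y : `|y| <= 1 ->
  exists2 e, mean P (fun w => expR (y * X w)) e &
    1 + y ^+ 2 / 2 - 4 * y ^+ 4 <= e <= 1 + y ^+ 2 / 2 + 4 * y ^+ 4.
Proof.
move=> y1; have [m4 h4 m44] := mean_expR_norm.
have poly := meanD P _ _ _ _ (meanD P _ _ _ _ (meanD P _ _ _ _ (mean_cst P 1)
  (meanZ P y _ _ mean_X1)) (meanZ P (y ^+ 2 / 2) _ _ mean_X2))
  (meanZ P (y ^+ 3 / 6) _ _ mean_X3).
have taylor w := expR_taylor4 y (X w) y1.
have up := meanD P _ _ _ _ poly (meanZ P (y ^+ 4) _ _ h4).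
have lo := meanD P _ _ _ _ poly (meanZ P (- y ^+ 4) _ _ h4).
have leup w : expR (y * X w) <= 1 + y * X w + y ^+ 2 / 2 * X w ^+ 2 +
    y ^+ 3 / 6 * X w ^+ 3 + y ^+ 4 * expR `|X w|.
  have := taylor w; rewrite ler_norml => /andP[_].
  by rewrite lerBlDr addrC !exprMn; nra.
have lelo w : 1 + y * X w + y ^+ 2 / 2 * X w ^+ 2 +
    y ^+ 3 / 6 * X w ^+ 3 + - y ^+ 4 * expR `|X w| <= expR (y * X w).
  have := taylor w; rewrite ler_norml => /andP[+ _].
  by rewrite lerBrDr addrC !exprMn; nra.
have [||e he] := @mean_dominated _ _ _ P (fun w => expR (y * X w)) _ _ _ up.
- by apply: measurableT_comp => //; exact: measurable_funM.
- by move=> w; rewrite ger0_norm ?expR_ge0.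
have y4 : 0 <= y ^+ 4 by rewrite exprn_even_ge0.
exists e => //; apply/andP; split.
  by have := mean_le P _ _ _ _ lo he lelo; nra.
by have := mean_le P _ _ _ _ he up leup; nra.
Qed.

End moments.

(** * Exponential moments of linear forms in the couplings *)

Section exponential_moments.
Context {d : measure_display} {T : measurableType d} {R : realType}.
Context {P : probability T R} {I : finType}.
Variables (h : I -> {RV P >-> R}) (A : {set I}).
Hypothesis ind : mutually_independent A h.
Hypothesis mom : forall p, p \in A ->
    [/\ ('E_P[h p] = 0)%E,
        ('E_P[(fun w => h p w ^+ 3)%R] = 0)%E,
        ('E_P[(fun w => h p w ^+ 2)%R] = 1)%E,
        ('E_P[(fun w => expR (h p w))%R] < 2%:E)%E &
        ('E_P[(fun w => expR (- h p w))%R] < 2%:E)%E].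

Lemma mean_expR_sum (y : I -> R) : (forall p, p \in A -> `|y p| <= 1) ->
  exists2 e, mean P (fun w => expR (\sum_(p in A) y p * h p w)) e &
    [/\ 0 <= e, e <= expR (\sum_(p in A) (y p ^+ 2 / 2 + 4 * y p ^+ 4)) &
      (forall p, p \in A -> y p ^+ 2 <= 1 / 10) ->
      expR (\sum_(p in A) (y p ^+ 2 / 2 - 5 * y p ^+ 4)) <= e].
Proof.
move=> y1; pose phi p := fine (\int[P]_w (expR (y p * h p w))%:E)%E.
have H p : p \in A -> mean P (fun w => expR (y p * h p w)) (phi p) /\
    1 + y p ^+ 2 / 2 - 4 * y p ^+ 4 <= phi p <= 1 + y p ^+ 2 / 2 + 4 * y p ^+ 4.
  move=> pA; have [m1 m3 m2 mp mm] := mom p pA.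
  have [e he eb] := mean_expRM (h p) m1 m3 m2 mp mm _ (y1 p pA).
  by rewrite /phi (proj2 he).
have phi0 p : p \in A -> 0 <= phi p.
  move=> /H[hp _]; apply: (mean_le P _ _ _ _ (mean_cst P 0) hp) => w.
  exact: expR_ge0.
exists (\prod_(p in A) phi p).
  apply: eq_mean (mean_prod h A ind A (fun p x => expR (y p * x)) phi _ _ _ _) => //.
  - by move=> w; rewrite expR_sum.
  - by move=> p; apply: measurableT_comp => //; exact: measurable_funM.
  - by move=> p pA; exact: (H p pA).1.
split.
- exact: prodr_ge0.
- rewrite expR_sum; apply: ler_prod => p pA; rewrite phi0//=.
  have [_ /andP[_ le]] := H p pA; apply: le_trans le _.
  rewrite -addrA; exact: expR_ge1Dx.
(* With [z = y p ^+ 2 <= 1 / 10], the exponent [u = z / 2 - 5 z^2] lies in [[0, 1/2]], where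
   [expR u <= 1 + u + 2 u^2]. Since [2 u^2 <= z^2 / 2], this is at most [1 + z / 2 - 4 z^2]. *)
move=> y10; rewrite expR_sum; apply: ler_prod => p pA; rewrite expR_ge0/=.
have [_ /andP[le _]] := H p pA; apply: le_trans le.
have y2 := sqr_ge0 (y p); have := y10 p pA.
have -> : y p ^+ 4 = (y p ^+ 2) ^+ 2 by rewrite -exprM.
move: (y p ^+ 2) y2 => z z0 z10.
apply: le_trans (expR_taylor2_le _ _) _; nra.
Qed.

End exponential_moments.

(** * Partition function *)

Section spins.
Context {R : realType} {N : nat}.
Local Notation config := {ffun 'I_N -> bool}.
Implicit Types (s : config) (p i j : 'I_N) (J : {set 'I_N}).

(** Applied to constants it counts the pairs; applied to products of two spin configurations it
    turns their interaction into a squared overlap. *)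
Lemma sum_pairs_lt (e : 'I_N -> R) :
  (\sum_i e i) ^+ 2 =
  \sum_i e i ^+ 2 + 2 * \sum_(p in pairs_lt N) e p.1 * e p.2.
Proof.
have pairE (Q : pred ('I_N * 'I_N)) : \sum_(p | Q p) e p.1 * e p.2 =
    \sum_i \sum_(j | Q (i, j)) e i * e j.
  by rewrite pair_big_dep; apply: eq_big => -[].
have sq : (\sum_i e i) ^+ 2 = \sum_i \sum_j e i * e j.
  by rewrite expr2 mulr_suml; apply: eq_bigr => i _; rewrite mulr_sumr.
have lt : \sum_(p in pairs_lt N) e p.1 * e p.2 =
    \sum_(i : 'I_N) \sum_(j : 'I_N | (i < j)%N) e i * e j.
  by rewrite pairE; apply: eq_bigr => i _; apply: eq_bigl => j; rewrite finset.inE.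
have gt : \sum_(i : 'I_N) \sum_(j : 'I_N | (i < j)%N) e i * e j =
    \sum_(i : 'I_N) \sum_(j : 'I_N | (j < i)%N) e i * e j.
  rewrite (exchange_big_dep predT)//=; apply: eq_bigr => i _.
  by apply: eq_bigr => j _; rewrite mulrC.
have -> : 2 * \sum_(p in pairs_lt N) e p.1 * e p.2 =
    \sum_(i : 'I_N) \sum_(j : 'I_N | (i < j)%N) e i * e j +
    \sum_(i : 'I_N) \sum_(j : 'I_N | (j < i)%N) e i * e j.
  by rewrite -gt -lt; ring.
rewrite sq -!big_split /=; apply: eq_bigr => i _.
rewrite (bigD1 i)//= expr2; congr (_ + _).
rewrite (bigID (fun j : 'I_N => (i < j)%N))/=; congr (_ + _); apply: eq_bigl => j.
  by rewrite neq_ltn; case: ltngtP.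
by rewrite neq_ltn; case: ltngtP.
Qed.

Lemma card_pairs_lt : (#|pairs_lt N|%:R : R) = (N%:R ^+ 2 - N%:R) / 2.
Proof.
have := sum_pairs_lt (fun=> 1).
rewrite mulr1 expr1n !sumr_const card_ord -/(N%:R).
rewrite -[1 *+ #|_|]/(#|pairs_lt N|%:R : R); lra.
Qed.

Lemma spin_sqr s i : spin R s i ^+ 2 = 1.
Proof. by rewrite /spin sqrr_sign. Qed.

Lemma norm_spin s i : `|spin R s i| = 1.
Proof. by rewrite /spin normr_sign. Qed.

Definition flip p s : config := [ffun i => if i == p then ~~ s i else s i].

Lemma flipK p : involutive (flip p).
Proof.
by move=> s; apply/ffunP => i; rewrite !ffunE; case: eqP => // _; rewrite negbK.
Qed.

Lemma spin_flip p s i :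
  spin R (flip p s) i = if i == p then - spin R s i else spin R s i.
Proof.
rewrite /spin ffunE; case: eqP => // _.
by case: (s i); rewrite /= ?expr0 ?expr1 ?opprK.
Qed.

Lemma sum_flip p (f : config -> R) : \sum_s f (flip p s) = \sum_s f s.
Proof. by rewrite [RHS](reindex_inj (inv_inj (flipK p))). Qed.

(** Flipping the spin at [p.1] permutes the configurations and reverses the sign of each term. *)
Lemma sum_spin_pair (p : 'I_N * 'I_N) : p \in pairs_lt N ->
  \sum_s spin R s p.1 * spin R s p.2 = 0.
Proof.
rewrite finset.inE => lt.
have ne : (p.2 == p.1) = false by rewrite -val_eqE; exact: gtn_eqF.
have := sum_flip p.1 (fun s => spin R s p.1 * spin R s p.2).
under eq_bigr => s _.
  rewrite !spin_flip eqxx ne mulNr.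
  over.
rewrite sumrN; lra.
Qed.

(** Each spin in [J] is averaged by [expR_sqr_sign_le], which replaces [a] by [a / (1 - 2 a)];
    iterating [k] times gives [a / (1 - 2 a k)], and the prefactors telescope. *)
Lemma sum_spin_gauss (c : 'I_N -> R) J : (forall i, c i ^+ 2 = 1) ->
  forall a y, 0 <= a -> 2 * a * #|J|%:R < 1 ->
  \sum_s expR (a * (y + \sum_(i in J) c i * spin R s i) ^+ 2) <=
    2 ^+ N * ((1 - 2 * a * #|J|%:R)^-1 *
      expR (a / (1 - 2 * a * #|J|%:R) * y ^+ 2)).
Proof.
move=> c1; elim/(@finset_induction 'I_N): J => [|p J pJ IH] a y a0.
  rewrite finset.cards0 mulr0 subr0 invr1 mul1r mulr1 => _.
  under eq_bigr do rewrite big_set0 addr0.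
  by rewrite sumr_const card_ffun card_bool card_ord -[leLHS]mulr_natl natrX.
rewrite finset.cardsU1 pJ /= natrD => aJ.
have J0 : 0 <= #|J|%:R :> R by [].
have a1 : 2 * a < 1 by nra.
pose S s := \sum_(i in J) c i * spin R s i.
have Sflip s : S (flip p s) = S s.
  apply: eq_bigr => i iJ; rewrite spin_flip; case: eqVneq => // ip.
  by rewrite -ip iJ in pJ.
pose a' := a / (1 - 2 * a).
have step : \sum_s expR (a * (y + \sum_(i in (p |: J)%SET) c i * spin R s i) ^+ 2)
    <= (1 - 2 * a)^-1 * \sum_s expR (a' * (y + S s) ^+ 2).
  under eq_bigr do rewrite big_setU1//= -/(S _).
  pose f s := expR (a * (y + (c p * spin R s p + S s)) ^+ 2).
  rewrite -[leLHS]/(\sum_s f s).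
  (* Pairing each configuration with its flip at [p] isolates the two signs of that spin. *)
  have -> : \sum_s f s = \sum_s (f s + f (flip p s)) / 2.
    by rewrite -mulr_suml big_split /= sum_flip; lra.
  rewrite mulr_sumr; apply: ler_sum => s _.
  rewrite /f Sflip spin_flip eqxx.
  apply: le_trans (expR_sqr_sign_le _ _ a0 a1).
  have : c p * spin R s p = 1 \/ c p * spin R s p = -1.
    have /eqP : (c p * spin R s p) ^+ 2 = 1 by rewrite exprMn c1 spin_sqr mulr1.
    by rewrite sqrf_eq1 => /orP[] /eqP; [left|right].
  have -> : y + (c p * - spin R s p + S s) = y + S s - c p * spin R s p by ring.
  have -> : y + (c p * spin R s p + S s) = y + S s + c p * spin R s p by ring.
  by case=> ->; rewrite ?opprK// addrC.
apply: le_trans step _.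
have d1 : 0 < 1 - 2 * a by lra.
have a'0 : 0 <= a' by rewrite divr_ge0// ltW.
have dE : 1 - 2 * a' * #|J|%:R = (1 - 2 * a * (1 + #|J|%:R)) / (1 - 2 * a).
  by rewrite /a'; field; rewrite gt_eqF.
have d2 : 0 < 1 - 2 * a * (1 + #|J|%:R) by lra.
have a'J : 2 * a' * #|J|%:R < 1 by rewrite -subr_gt0 dE divr_gt0.
apply: le_trans (ler_wpM2l _ (IH a' y a'0 a'J)) _; first by rewrite invr_ge0 ltW.
rewrite dE le_eqVlt; apply/orP; left; apply/eqP.
rewrite mulrCA; congr (_ * _); rewrite mulrA; congr (_ * expR _).
  by field; rewrite !gt_eqF.
by rewrite /a'; field; rewrite !gt_eqF.
Qed.

End spins.

(** * Positivity, Lipschitz bound and measurability of the free energy *)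

Section partition_function.
Context {R : realType} {N : nat} (beta : R).
Hypothesis beta0 : 0 <= beta.
Local Notation pair := ('I_N * 'I_N)%type.
Implicit Types (g : pair -> R).

(** Jensen's inequality by way of [expR u >= 1 + u], the linear term averaging to zero over the
    spins. *)
Lemma Z_ge1 g : 1 <= Z beta g.
Proof.
rewrite /Z mulrC ler_pdivlMr ?exprn_gt0// mul1r.
have -> : (2 : R) ^+ N = \sum_(s : {ffun 'I_N -> bool}) 1.
  by rewrite sumr_const card_ffun card_bool card_ord natrX.
set x := beta / _.
have S0 : \sum_(s : {ffun 'I_N -> bool}) x * \sum_(p in pairs_lt N)
    g p * spin R s p.1 * spin R s p.2 = 0.
  rewrite -mulr_sumr exchange_big /= big1 ?mulr0// => p pN.
  under eq_bigr do rewrite -mulrA.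
  by rewrite -mulr_sumr sum_spin_pair ?mulr0.
rewrite -[leLHS]addr0 -[X in _ + X <= _]S0. rewrite -big_split /=; apply: ler_sum => s _.
exact: expR_ge1Dx.
Qed.

(** Products of spins have modulus 1, so every exponent in [Z] moves by at most the last term. *)
Lemma Z_update (p : pair) g x : p \in pairs_lt N ->
  ln (Z beta (update g p x)) <=
    ln (Z beta g) + beta / Num.sqrt N%:R * `|x - g p|.
Proof.
move=> pN; have Z0 (v : pair -> R) : 0 < Z beta v by apply: lt_le_trans (Z_ge1 v).
set a := beta / _.
have a0 : 0 <= a by rewrite divr_ge0// sqrtr_ge0.
rewrite -[a * _]expRK -lnM ?posrE ?expR_gt0// ler_ln ?posrE//; last first.
  exact: mulr_gt0 (Z0 _) (expR_gt0 _).
rewrite /Z -/a -mulrA ler_wpM2l ?invr_ge0 ?exprn_ge0// mulr_suml.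
apply: ler_sum => s _; rewrite -expRD ler_expR -mulrDr ler_wpM2l//.
rewrite (bigD1 p)//= [in leRHS](bigD1 p)//= /update eqxx.
rewrite [X in _ + X <= _](_ : _ = \sum_(i in pairs_lt N | i != p)
    g i * spin R s i.1 * spin R s i.2); last first.
  by apply: eq_bigr => i /andP[_ /negbTE ->].
rewrite addrAC lerD2r -lerBlDl -mulrBl -mulrBl.
by apply: le_trans (ler_norm _) _; rewrite !normrM !norm_spin !mulr1.
Qed.

Lemma coordwise_measurable_Z :
  coordwise_measurable (fun g : pair -> R => ln (Z beta g)).
Proof.
move=> d S u mu; apply: measurableT_comp => //; rewrite /Z.
apply: measurable_funM => //; apply: measurable_sum => s.
apply: measurableT_comp => //; apply: measurable_funM => //.
under eq_fun do rewrite -big_enum.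
apply: measurable_sum => p.
by do 2 apply: measurable_funM => //.
Qed.

End partition_function.

(** * Moments of the partition function and bounds on the free energy *)

Section free_energy.
Context {d : measure_display} {T : measurableType d} {R : realType}.
Context {P : probability T R} {N : nat}.
Variables (h : 'I_N * 'I_N -> {RV P >-> R}) (beta : R).
Hypothesis N0 : (0 < N)%N.
Hypothesis ind : mutually_independent (pairs_lt N) h.
Hypothesis mom : forall p, p \in pairs_lt N ->
    [/\ ('E_P[h p] = 0)%E,
        ('E_P[(fun w => h p w ^+ 3)%R] = 0)%E,
        ('E_P[(fun w => h p w ^+ 2)%R] = 1)%E,
        ('E_P[(fun w => expR (h p w))%R] < 2%:E)%E &
        ('E_P[(fun w => expR (- h p w))%R] < 2%:E)%E].
Hypothesis beta01 : 0 < beta < 1.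

Local Notation b := (beta ^+ 2).
Local Notation n := (N%:R : R).
Local Notation x := (beta / Num.sqrt N%:R).
Local Notation Zh w := (Z beta (fun p => h p w)).

Let n0 : 0 < n. Proof. by rewrite ltr0n. Qed.
Let n1 : 1 <= n. Proof. by rewrite ler1n. Qed.
Let b01 : 0 < b < 1.
Proof. by have /andP[? ?] := beta01; apply/andP; split; nra. Qed.
Let b2 : b ^+ 2 <= 1.
Proof. by have /andP[? ?] := b01; rewrite exprn_ile1// ltW. Qed.
Let b2n : b ^+ 2 * (n - 1) <= n.
Proof.
have := n1 => ?; apply: (@le_trans _ _ (n - 1)); last lra.
by apply: ler_piMl => //; lra.
Qed.
Let sqrtn : Num.sqrt n ^+ 2 = n. Proof. by rewrite sqr_sqrtr// ltW. Qed.
Let sqrtn0 : 0 < Num.sqrt n. Proof. by rewrite sqrtr_gt0. Qed.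
Let sqrtn1 : 1 <= Num.sqrt n.
Proof. by rewrite -[leLHS]sqrtr1 ler_sqrt// ltW. Qed.
Let x2 : x ^+ 2 = b / n. Proof. by rewrite exprMn exprVn sqrtn. Qed.
Let x4 : x ^+ 4 = b ^+ 2 / n ^+ 2.
Proof. by rewrite (exprM x 2 2) x2 exprMn exprVn. Qed.
Let x01 : 0 <= x <= 1.
Proof.
have /andP[? ?] := beta01; apply/andP; split; first by rewrite divr_ge0// ltW.
rewrite ler_pdivrMr// mul1r.
by apply: le_trans sqrtn1; rewrite ltW.
Qed.

(** For each configuration the [n (n - 1) / 2] coefficients have square [b / n], so the quadratic
    terms sum to [b (n - 1) / 4]. The quartic sum is at most [1 / 2], giving the error 2 above and
    [b / 4 + 5 / 2 <= 3] below; [10 <= N] ensures [b / n <= 1 / 10]. *)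
Lemma mean_Z : exists2 M, mean P (fun w => Zh w) M &
  M <= expR (b * n / 4 + 2) /\
  ((10 <= N)%N -> expR (b * n / 4 - 3) <= M).
Proof.
have /andP[b0 b1] := b01; have /andP[x0 x1] := x01.
pose L := if (10 <= N)%N then expR (b * n / 4 - 3) else 0.
have H (s : {ffun 'I_N -> bool}) : exists2 e, mean P (fun w =>
    expR (x * \sum_(p in pairs_lt N) h p w * spin R s p.1 * spin R s p.2)) e &
    L <= e <= expR (b * n / 4 + 2).
  pose y p := x * (spin R s p.1 * spin R s p.2).
  have yx p : `|y p| = x by rewrite /y normrM (ger0_norm x0) normrM !norm_spin !mulr1.
  have y2 p : y p ^+ 2 = b / n by rewrite -x2 -(yx p) real_normK ?num_real.
  have y4 p : y p ^+ 4 = b ^+ 2 / n ^+ 2 by rewrite (exprM _ 2 2) y2 exprMn exprVn.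
  have [|e he [e0 eu el]] := mean_expR_sum h (pairs_lt N) ind mom y.
    by move=> p _; rewrite yx.
  exists e.
    apply: eq_mean he => w; rewrite mulr_sumr; congr expR; apply: eq_bigr => p _.
    by rewrite /y; ring.
  have sE (c1 c2 : R) : \sum_(p in pairs_lt N) (c1 * y p ^+ 2 + c2 * y p ^+ 4) =
      c1 * (b * (n - 1) / 2) + c2 * (b ^+ 2 * (n - 1) / (2 * n)).
    under eq_bigr do rewrite y2 y4.
    by rewrite sumr_const -[_ *+ #|_|]mulr_natl card_pairs_lt; field; rewrite gt_eqF.
  have q1 : b ^+ 2 * (n - 1) / (2 * n) <= 1 / 2.
    by have := b2n; have := n0 => ? ?; rewrite ler_pdivrMr; lra.
  apply/andP; split.
    rewrite /L; case: ifP => // N10; apply: le_trans (el _).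
      have := sE (1 / 2) (- 5).
      under eq_bigr do rewrite -[1 / 2 * _]mulrC mulrA mulr1 mulNr.
      by move=> ->; rewrite ler_expR; nra.
    move=> p _; rewrite y2 ler_pdivrMr//.
    have : (10 : R) <= n by rewrite ler_nat.
    lra.
  apply: le_trans eu _.
  have := sE (1 / 2) 4.
  under eq_bigr do rewrite -[1 / 2 * _]mulrC mulrA mulr1.
  by move=> ->; rewrite ler_expR; nra.
have [M hM /andP[ML MU]] := mean_sum_bounds _ _ _ _ H.
exists (2 ^- N * M); first exact: meanZ.
have cardE (c : R) : 2 ^- N * \sum_(s : {ffun 'I_N -> bool}) c = c.
  rewrite sumr_const card_ffun card_bool card_ord -[c *+ _]mulr_natl natrX mulrA.
  by rewrite mulVf ?mul1r// expf_neq0// pnatr_eq0.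
have c0 : 0 <= 2 ^- N :> R by rewrite invr_ge0 exprn_ge0.
split; first by rewrite -[leRHS]cardE ler_wpM2l.
move=> N10; have -> : expR (b * n / 4 - 3) = L by rewrite /L N10.
by rewrite -[leLHS]cardE ler_wpM2l.
Qed.

(** [Z ^+ 2] is a sum over two replicas, whose interaction contributes [b / (2 n)] times the squared
    overlap [S]. Then [sum_spin_gauss] with [a = b / (2 n)] yields the factor [(1 - b)^-1]. The
    condition [4 <= N] keeps the coefficients, of modulus at most [2 x], below 1. *)
Lemma mean_Z_sqr : (4 <= N)%N -> exists2 M, mean P (fun w => Zh w ^+ 2) M &
  M <= expR (b * n / 2 + 32) / (1 - b).
Proof.
move=> N4.
have /andP[b0 b1] := b01; have /andP[x0 x1] := x01.
pose S (s s' : {ffun 'I_N -> bool}) := \sum_i spin R s i * spin R s' i.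
pose U s s' := expR (b * n / 2 + 32) * expR (b / (2 * n) * S s s' ^+ 2).
have H s s' : exists2 e, mean P (fun w =>
    expR (x * \sum_(p in pairs_lt N) h p w * spin R s p.1 * spin R s p.2) *
    expR (x * \sum_(p in pairs_lt N) h p w * spin R s' p.1 * spin R s' p.2)) e &
    0 <= e <= U s s'.
  pose y p := x * (spin R s p.1 * spin R s p.2 + spin R s' p.1 * spin R s' p.2).
  pose eta i := spin R s i * spin R s' i.
  have y2 p : y p ^+ 2 = 2 * (b / n) * (1 + eta p.1 * eta p.2).
    rewrite exprMn x2 sqrrD !exprMn !spin_sqr /eta; ring.
  have yb p : `|y p| <= 2 * x.
    rewrite /y normrM ger0_norm// mulrC ler_wpM2r//.
    by apply: le_trans (ler_normD _ _) _; rewrite !normrM !norm_spin !mulr1.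
  have n4 : (4 : R) <= n by rewrite ler_nat.
  have x12 : 2 * x <= 1.
    have : x ^+ 2 <= 1 / 4 by rewrite x2 ler_pdivrMr//; lra.
    by move: (x) x0 => z z0; rewrite expr2; nra.
  have y4 p : y p ^+ 4 <= 16 * (b ^+ 2 / n ^+ 2).
    rewrite -x4 -[leLHS]ger0_norm ?exprn_even_ge0// normrX.
    have -> : 16 * x ^+ 4 = (2 * x) ^+ 4 by ring.
    by rewrite ler_pXn2r// nnegrE (mulr_ge0 _ x0).
  have [|e he [e0 eu _]] := mean_expR_sum h (pairs_lt N) ind mom y.
    by move=> p _; apply: le_trans (yb p) x12.
  exists e.
    apply: eq_mean he => w; rewrite -expRD -mulrDr -big_split mulr_sumr.
    by congr expR; apply: eq_bigr => p _; rewrite /y /=; ring.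
  rewrite e0 /=; apply: le_trans eu _; rewrite /U -expRD ler_expR.
  apply: (@le_trans _ _ (\sum_(p in pairs_lt N)
      (b / n + 64 * (b ^+ 2 / n ^+ 2) + b / n * (eta p.1 * eta p.2)))).
    by apply: ler_sum => p _; rewrite y2; have := y4 p; lra.
  rewrite big_split /= -mulr_sumr sumr_const -[_ *+ #|_|]mulr_natl card_pairs_lt.
  have := sum_pairs_lt eta; rewrite -/(S s s').
  have -> : \sum_i eta i ^+ 2 = n.
    under eq_bigr do rewrite /eta exprMn !spin_sqr mulr1.
    by rewrite sumr_const card_ord.
  move: (\sum_(p in _) _) (S s s') => E Q QE.
  have -> : E = (Q ^+ 2 - n) / 2 by rewrite QE; field.
  (* The quartic errors, at most [4 * 16 * x ^+ 4] per pair, add up to at most 32. *)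
  have -> : (n ^+ 2 - n) / 2 * (b / n + 64 * (b ^+ 2 / n ^+ 2)) +
      b / n * ((Q ^+ 2 - n) / 2) =
      b * n / 2 - b + 32 * (b ^+ 2 * (n - 1) / n) + b / (2 * n) * Q ^+ 2.
    by field; rewrite gt_eqF.
  have : b ^+ 2 * (n - 1) / n <= 1.
    by rewrite ler_pdivrMr// mul1r.
  lra.
have H1 s := mean_sum_bounds _ _ _ _ (H s).
have [M hM /andP[_ MU]] := mean_sum_bounds _ _ (fun _ => \sum_s' 0) _ H1.
have c0 : 0 <= 2 ^- N :> R by rewrite invr_ge0 exprn_ge0.
exists (2 ^- N * 2 ^- N * M).
  apply: eq_mean (meanZ P (2 ^- N * 2 ^- N) _ _ hM) => w.
  rewrite /Z expr2 mulrACA; congr (_ * _).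
  by rewrite [RHS]mulr_suml; apply: eq_bigr => s _; rewrite [RHS]mulr_sumr.
have gauss s : \sum_s' U s s' <= expR (b * n / 2 + 32) * (2 ^+ N * (1 - b)^-1).
  rewrite -mulr_sumr ler_wpM2l ?expR_ge0//.
  have a0 : 0 <= b / (2 * n).
    by apply: divr_ge0; [exact: ltW|rewrite mulr_ge0// ltW].
  have := sum_spin_gauss (spin R s) [set: 'I_N]%SET (spin_sqr s) _ 0 a0.
  have -> : 2 * (b / (2 * n)) * #|[set: 'I_N]%SET|%:R = b.
    by rewrite finset.cardsT card_ord; field; rewrite gt_eqF.
  rewrite expr0n /= mulr0 expR0 mulr1 => /(_ b1); apply: le_trans.
  apply: ler_sum => s' _; rewrite /S add0r.
  by under [in leRHS]eq_bigl do rewrite finset.in_setT.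
apply: le_trans (ler_wpM2l (mulr_ge0 c0 c0) MU) _.
apply: le_trans (ler_wpM2l (mulr_ge0 c0 c0) (ler_sum _ (fun s _ => gauss s))) _.
rewrite sumr_const card_ffun card_bool card_ord -[_ *+ (2 ^ N)]mulr_natl natrX.
rewrite le_eqVlt; apply/orP; left; apply/eqP.
by field; rewrite expf_neq0 ?pnatr_eq0// gt_eqF// subr_gt0.
Qed.

(** Concentration with Lipschitz constant [x]: the variance proxy is [x ^+ 2 = b / n] times the
    number of pairs, which is at most [n]. *)
Lemma mean_lnZ : exists m, mean P (fun w => ln (Zh w)) m /\
  forall l, `|l| * x <= 1 ->
    exists2 e, mean P (fun w => expR (l * ln (Zh w))) e &
      e <= expR (l * m + 16 * (l ^+ 2 * n)).
Proof.
have /andP[b0 b1] := b01; have /andP[x0 x1] := x01.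
have beta0 : 0 <= beta by have /andP[/ltW] := beta01.
pose F (g : 'I_N * 'I_N -> R) := ln (Z beta g).
have F0 g : 0 <= F g by apply: ln_ge0; exact: Z_ge1.
have h1 p : p \in pairs_lt N -> exists2 mu, mean P (fun w => `|h p w|) mu & mu <= 1.
  by move=> /mom[? ? ? ? ?]; exact: mean_norm.
have h4 p : p \in pairs_lt N ->
    exists2 m4, mean P (fun w => expR `|h p w|) m4 & m4 <= 4.
  by move=> /mom[? ? ? ? ?]; exact: mean_expR_norm.
have FE w : F (resample h (pairs_lt N) (fun=> 0) w) = ln (Zh w).
  rewrite /F /Z; congr (ln (_ * _)); apply: eq_bigr => s _; congr (expR (_ * _)).
  by apply: eq_bigr => p pN; rewrite /resample pN.
have [m [hm mgf]] := mean_expR_resample h (pairs_lt N) x F ind x0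
  (coordwise_measurable_Z beta) F0 (fun p g y pN => Z_update beta beta0 p g y pN)
  h1 h4 (pairs_lt N) (subxx _) (fun=> 0).
exists m; split; first exact: eq_mean hm.
move=> l /mgf[e he ee]; exists e.
  by apply: eq_mean he => w; rewrite FE.
apply: le_trans ee _; rewrite ler_expR lerD2l -mulrA ler_wpM2l//.
rewrite exprMn x2 -mulrA ler_wpM2l ?sqr_ge0// card_pairs_lt.
rewrite mulrAC ler_pdivrMr//.
have := n1; move: (n) => z z1; nra.
Qed.

(** Jensen's inequality through the tangent line [ln z <= c - 1 + expR (- c) * z]. *)
Lemma mean_lnZ_le m : mean P (fun w => ln (Zh w)) m -> m <= b * n / 4 + 2.
Proof.
move=> hm; have [M hM [MU _]] := mean_Z; set c := _ + 2 in MU *.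
have Z0 w : 0 < Zh w by apply: lt_le_trans (Z_ge1 beta _).
have := mean_le P _ _ _ _ hm
  (meanD P _ _ _ _ (mean_cst P (c - 1)) (meanZ P (expR (- c)) _ _ hM)).
move=> /(_ _)/le_trans; apply.
  move=> w; have := expR_ge1Dx (- c + ln (Zh w)).
  by rewrite expRD lnK ?posrE//; lra.
have := ler_wpM2l (expR_ge0 (- c)) MU; rewrite -expRD addNr expR0; lra.
Qed.

Lemma mean_lnZ_ge m : mean P (fun w => ln (Zh w)) m ->
  b * n / 4 - m <= 17 * Num.sqrt (n * (41 - ln (1 - b))).
Proof.
move=> hm; have /andP[b0 b1] := b01; have /andP[x0 x1] := x01.
have Z0 w : 0 < Zh w by apply: lt_le_trans (Z_ge1 beta _).
pose L := - ln (1 - b).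
have L0 : 0 <= L by rewrite oppr_ge0 ln_le0//; lra.
have LE : (1 - b)^-1 = expR L by rewrite expRN lnK// posrE subr_gt0.
rewrite -/L; set r := Num.sqrt _.
have r0 : 0 <= r by exact: sqrtr_ge0.
have r2 : r ^+ 2 = n * (41 + L) by rewrite sqr_sqrtr// mulr_ge0//; lra.
have m0 : 0 <= m.
  by apply: (mean_le P _ _ _ _ (mean_cst P 0) hm) => w; apply: ln_ge0; exact: Z_ge1.
(* When [n] is small, [n <= r], and [m >= 0] already gives the bound. *)
have [nL|Ln] := ltP n (41 + L).
  have nr : n <= r.
    rewrite -(@ler_pXn2r _ 2)// ?nnegrE// r2 expr2.
    by rewrite ler_wpM2l// ltW.
  by nra.
have N41 : (41 <= N)%N by rewrite -(ler_nat R); lra.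
have N10 : (10 <= N)%N by apply: leq_trans N41.
have N4 : (4 <= N)%N by apply: leq_trans N41.
have [m' [hm' mgf]] := mean_lnZ.
have mE : m' = m by case: hm' hm => [_ mi] [_]; rewrite mi => -[].
subst m'.
have [M hM [_ /(_ N10) ML]] := mean_Z.
have [M2 hM2 M2U] := mean_Z_sqr N4.
(* Chosen so that [l ^+ 2 * n = 41 + L], balancing the concentration cost against the loss in the
   threshold; [n >= 41 + L] gives [l <= 1]. *)
pose l := r / n.
have l0 : 0 < l by rewrite divr_gt0// sqrtr_gt0 mulr_gt0//; lra.
have l1 : l <= 1.
  rewrite ler_pdivrMr// mul1r -(@ler_pXn2r _ 2)// ?nnegrE// r2 expr2.
  by rewrite ler_wpM2l.
have l2n : l ^+ 2 * n = 41 + L.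
  by rewrite exprMn r2 exprVn; field; rewrite gt_eqF.
have [|e he ee] := mgf l.
  by rewrite gtr0_norm//; apply: mulr_ile1 => //; exact: ltW.
(* The shift [37 + L] brings the second-moment term, at most [expR (2 A + 32 + L - q)], down to
   [expR (A - 5)]. *)
pose A := b * n / 4; pose q := A + 37 + L.
have l01 : 0 <= l <= 1 by rewrite ltW.
have MU := mean_le P _ _ _ _ hM (meanD P _ _ _ _
  (meanZ P (expR ((1 - l) * q)) _ _ he) (meanZ P (expR (- q)) _ _ hM2)).
have {}MU : M <= expR ((1 - l) * q) * e + expR (- q) * M2.
  apply: MU => w; have := expR_interpolation (ln (Zh w)) l q l01.
  by rewrite lnK ?posrE.
have t1 : expR ((1 - l) * q) * e <= expR ((1 - l) * q + (l * m + 16 * (41 + L))).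
  by rewrite -l2n expRD ler_wpM2l ?expR_ge0.
have t2 : expR (- q) * M2 <= expR (A - 5).
  apply: le_trans (ler_wpM2l (expR_ge0 _) M2U) _.
  rewrite LE -!expRD ler_expR /q /A; lra.
(* Follows from [v + 1 <= v^2] for [v = expR 1 >= 2]. *)
have t3 : expR (A - 4) + expR (A - 5) <= expR (A - 3).
  have -> : A - 3 = (A - 5) + 1 + 1 by ring.
  have -> : A - 4 = (A - 5) + 1 by ring.
  rewrite !(expRD _ 1); have := expR_ge1Dx (1 : R); have := expR_gt0 (A - 5).
  move: (expR (A - 5)) (expR 1) => u v u0 v1.
  have : 0 <= u * (v * v - v - 1) by apply: mulr_ge0; [exact: ltW|nra].
  lra.
have : expR (A - 4) <= expR ((1 - l) * q + (l * m + 16 * (41 + L))).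
  by rewrite -/A in ML; lra.
rewrite ler_expR => key.
(* [key] rearranges to [l (q - m) <= (q - A + 4) + 16 (41 + L)], and [q - A + 4 = 41 + L]; moreover
   [q >= A]. *)
have lAm : l * (A - m) <= 17 * (41 + L).
  have : 0 <= l * (37 + L) by rewrite mulr_ge0 ?(ltW l0)//; lra.
  by move: key; rewrite /q; move: (A) (l) (L) => A' l' L'; lra.
have : l * (A - m) <= l * (17 * r).
  apply: le_trans lAm _; rewrite -l2n /l le_eqVlt; apply/orP; left; apply/eqP.
  by field; rewrite gt_eqF.
by rewrite ler_pM2l.
Qed.

Lemma lnZ_tail m t : mean P (fun w => ln (Zh w)) m -> 0 <= t <= n ->
  (P [set w | (8 * t * Num.sqrt n <= `|ln (Zh w) - m|)%R] <=
    (2 * expR (- t ^+ 2))%:E)%E.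
Proof.
move=> hm /andP[t0 tn]; have /andP[x0 x1] := x01.
have [m' [hm' mgf]] := mean_lnZ.
have mE : m' = m by case: hm' hm => [_ mi] [_]; rewrite mi => -[].
subst m'.
(* Minimises [16 l^2 n - 8 l t sqrt n], with value [- t^2]; [t <= n] makes [l * x <= 1]. *)
pose l := t / (4 * Num.sqrt n).
have l0 : 0 <= l by rewrite divr_ge0// mulr_ge0// sqrtr_ge0.
have l2n : 16 * (l ^+ 2 * n) = t ^+ 2.
  by rewrite exprMn exprVn exprMn sqrtn; field; rewrite gt_eqF.
have lu : l * (8 * t * Num.sqrt n) = 2 * t ^+ 2.
  by rewrite /l; field; rewrite gt_eqF.
have lx : l * x <= 1.
  have -> : l * x = beta * t / (4 * Num.sqrt n ^+ 2) by rewrite /l; field; rewrite gt_eqF.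
  have /andP[? ?] := beta01.
  by rewrite sqrtn ler_pdivrMr ?mulr_gt0//; have := n0 => ?; nra.
have [|e1 h1 e1U] := mgf l; first by rewrite ger0_norm.
have [|e2 h2 e2U] := mgf (- l); first by rewrite normrN ger0_norm.
rewrite l2n in e1U; rewrite sqrrN l2n in e2U.
(* Sum of the exponential test functions of the two tails, at least 1 on the event. *)
have hg := meanD P _ _ _ _ (meanZ P (expR (- (2 * t ^+ 2) - l * m)) _ _ h1)
  (meanZ P (expR (- (2 * t ^+ 2) + l * m)) _ _ h2).
have mlnZ := mean_measurable P _ _ hm.
apply: (@le_trans _ _ (expR (- (2 * t ^+ 2) - l * m) * e1 +
    expR (- (2 * t ^+ 2) + l * m) * e2)%:E).
  apply: mean_markov hg _ _.
  - have -> : [set w | 8 * t * Num.sqrt n <= `|ln (Zh w) - m|] =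
        (fun w => `|ln (Zh w) - m|) @^-1` `[8 * t * Num.sqrt n, +oo[%classic.
      by apply/seteqP; split => w /=; rewrite in_itv/= andbT.
    rewrite -[_ @^-1` _]setTI.
    suff : measurable_fun setT (fun w => `|ln (Zh w) - m|) by apply.
    by apply: measurableT_comp => //; exact: measurable_funB.
  - by move=> w; rewrite addr_ge0// mulr_ge0// expR_ge0.
  move=> w /= big; rewrite -!expRD.
  have /(ler_wpM2l l0) := big; rewrite lu.
  case: (ger0P (ln (Zh w) - m)) => fm lf.
    apply: (@le_trans _ _ (expR (- (2 * t ^+ 2) - l * m + l * ln (Zh w)))).
      rewrite -[leLHS]expR0 ler_expR. lra.
    by rewrite lerDl expR_ge0.
  apply: (@le_trans _ _ (expR (- (2 * t ^+ 2) + l * m + - l * ln (Zh w)))).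
    rewrite -[leLHS]expR0 ler_expR; lra.
  by rewrite lerDr expR_ge0.
rewrite lee_fin.
have {}e1U := ler_wpM2l (expR_ge0 (- (2 * t ^+ 2) - l * m)) e1U.
have {}e2U := ler_wpM2l (expR_ge0 (- (2 * t ^+ 2) + l * m)) e2U.
apply: le_trans (lerD e1U e2U) _; rewrite -!expRD.
have -> : - (2 * t ^+ 2) - l * m + (l * m + t ^+ 2) = - t ^+ 2 by ring.
have -> : - (2 * t ^+ 2) + l * m + (- l * m + t ^+ 2) = - t ^+ 2 by ring.
lra.
Qed.

(** Since [ln 2 >= 1 / 2], one has [41 - ln (1 - b) <= 100 * ln (2 / (1 - b))], whence
    [170 = 17 * 10]. *)
Lemma free_energy_ge m : mean P (fun w => ln (Zh w)) m ->
  b * n / 4 - m <= 170 * (Num.sqrt n * Num.sqrt (ln (2 / (1 - b)))).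
Proof.
move=> hm; have /andP[b0 b1] := b01.
apply: le_trans (mean_lnZ_ge m hm) _.
have -> : 170 = 17 * 10 :> R by lra.
rewrite -mulrA ler_wpM2l// -(sqrtrM _ (ltW n0)).
have -> : 10 = Num.sqrt (100 : R).
  by have -> : 100 = 10 ^+ 2 :> R; [lra|rewrite sqrtr_sqr ger0_norm].
rewrite -sqrtrM// ler_wsqrtr// mulrCA (ler_wpM2l (ltW n0))//.
rewrite ln_div ?posrE ?subr_gt0//.
have : 1 / 2 <= ln 2 :> R.
  rewrite -ler_expR lnK ?posrE//.
  have := expR_le_inv1B (1 / 2 : R); rewrite -[X in _ -> _ <= X^-1](_ : 1 / 2 = _); last lra.
  by move=> /(_ _); rewrite div1r invrK; apply; lra.
have : ln (1 - b) <= 0 by rewrite ln_le0//; lra.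
lra.
Qed.

End free_energy.

(** * Deviation and mean bounds with a universal constant *)

Theorem theorem12p1 (R : realType) :
  exists K : R, 1 <= K /\
  forall (d : measure_display) (T : measurableType d) (P : probability T R)
    (N : nat) (h : 'I_N * 'I_N -> {RV P >-> R}) (beta : R),
  (0 < N)%N ->
  iid (pairs_lt N) h ->
  (forall p, p \in pairs_lt N ->
    [/\ ('E_P[h p] = 0)%E,
        ('E_P[(fun w => h p w ^+ 3)%R] = 0)%E,
        ('E_P[(fun w => h p w ^+ 2)%R] = 1)%E,
        ('E_P[(fun w => expR (h p w))%R] < 2%:E)%E &
        ('E_P[(fun w => expR (- h p w))%R] < 2%:E)%E]) ->
  0 < beta < 1 ->
  let logZ := fun w : T => ln (Z beta (fun p => h p w)) in
  (forall t : R, 0 < t < N%:R / K ->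
    (P [set w | (`|logZ w - beta ^+ 2 * N%:R / 4|
                 >= K * (t + Num.sqrt (ln (K / (1 - beta ^+ 2))))
                    * Num.sqrt N%:R)%R]
     <= (2 * expR (- t ^+ 2))%:E)%E) /\
  ((- (K / Num.sqrt N%:R) * Num.sqrt (ln (2 / (1 - beta ^+ 2))))%:E
     <= (N%:R^-1)%:E * 'E_P[logZ] - (beta ^+ 2 / 4)%:E
     <= (K / N%:R)%:E)%E.
Proof.
(* Exceeds 8 from the tail bound, 170 from the lower bound on the mean and 2 from the upper one. *)
exists 200; split; first lra.
move=> d T P N h beta N0 [ind _] mom beta01 logZ.
have n0 : 0 < N%:R :> R by rewrite ltr0n.
have n1 : 1 <= N%:R :> R by rewrite ler1n.
have /andP[b0 b1] : 0 < beta ^+ 2 < 1.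
  by have /andP[? ?] := beta01; apply/andP; split; nra.
have [m [hm _]] := mean_lnZ h beta N0 ind mom beta01.
have mU := mean_lnZ_le h beta N0 ind mom beta01 m hm.
have mL := free_energy_ge h beta N0 ind mom beta01 m hm.
set q := Num.sqrt (ln (2 / _)) in mL *.
have q0 : 0 <= q by exact: sqrtr_ge0.
set rn := Num.sqrt N%:R in mL *.
have rn1 : 1 <= rn by rewrite -[leLHS]sqrtr1 ler_sqrt// ltW.
have rn2 : rn * rn = N%:R by rewrite -expr2 sqr_sqrtr// ltW.
split.
  move=> t /andP[t0 tN]; set Q := Num.sqrt (ln (200 / _)).
  have qQ : q <= Q.
    rewrite ler_wsqrtr// ler_ln ?posrE ?divr_gt0 ?subr_gt0//.
    by rewrite ler_pM2r ?invr_gt0 ?subr_gt0//; lra.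
  (* Lets [200 * (Q * rn)] absorb the additive constant 2 of the upper bound on [m]. *)
  have Q1 : 1 / 2 <= Q.
    have -> : 1 / 2 = Num.sqrt ((1 / 2) ^+ 2) :> R by rewrite sqrtr_sqr ger0_norm.
    apply: ler_wsqrtr; rewrite -ler_expR lnK ?posrE ?divr_gt0 ?subr_gt0//.
    apply: (@le_trans _ _ (expR 1)); first by rewrite ler_expR; lra.
    apply: le_trans (@expR1_le4 R) _.
    by rewrite ler_pdivlMr ?subr_gt0//; lra.
  have tn : 0 <= t <= N%:R.
    by rewrite ltW//=; rewrite ltr_pdivlMr// in tN; lra.
  apply: le_trans (lnZ_tail h beta N0 ind mom beta01 m t hm tn).
  have mlnZ := mean_measurable P _ _ hm.
  have mE (c u : R) : measurable [set w | c <= `|logZ w - u|].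
    have -> : [set w | c <= `|logZ w - u|] =
        (fun w => `|logZ w - u|) @^-1` `[c, +oo[%classic.
      by apply/seteqP; split => w /=; rewrite in_itv/= andbT.
    rewrite -[_ @^-1` _]setTI.
    suff : measurable_fun setT (fun w => `|logZ w - u|) by apply.
    by apply: measurableT_comp => //; exact: measurable_funB.
  apply: le_measure; rewrite ?inE//.
  move=> w /= H; rewrite -/rn.
  have := ler_distD m (logZ w) (beta ^+ 2 * N%:R / 4).
  (* Recentring at [m] uses up the [Q] part of the threshold; the remaining [200 * (t * rn)] exceeds
     the level in [lnZ_tail]. *)
  have mA : `|m - beta ^+ 2 * N%:R / 4| <= 200 * (Q * rn).
    rewrite ler_norml.
    have : rn * q <= Q * rn by rewrite [leRHS]mulrC ler_wpM2l // (le_trans ler01).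
    have : 1 / 2 <= Q * rn.
      by apply: le_trans Q1 _; rewrite ler_peMr // sqrtr_ge0.
    by move=> ? ?; apply/andP; split; lra.
  have : 0 <= t * rn by rewrite mulr_ge0// ?ltW//; lra.
  have eH : 200 * (t + Q) * rn = 200 * (t * rn) + 200 * (Q * rn) by ring.
  by rewrite eH in H; rewrite -/(logZ w) -[8 * t * rn]mulrA; lra.
have -> : 'E_P[logZ]%E = m%:E by rewrite unlock; exact: (proj2 hm).
rewrite -EFinM -EFinB !lee_fin.
have -> : N%:R^-1 * m - beta ^+ 2 / 4 = (m - beta ^+ 2 * N%:R / 4) / N%:R.
  by field; rewrite gt_eqF.
have -> : - (200 / rn) * q = - (200 * (rn * q)) / N%:R.
  by rewrite -rn2; field; rewrite gt_eqF// (lt_le_trans ltr01).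
have : 0 <= rn * q by rewrite mulr_ge0 // (le_trans ler01).
by rewrite !ler_pM2r ?invr_gt0// => ?; apply/andP; split; lra.
Qed.
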